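(* Let $\alpha$ be fixed and let $p_1,p_2,\ldots$ be i.i.d. with distribution function $P$ as in the context. Let $q\in[0,1]$ and suppose $P$ is Simes-detectable at $q\alpha$. Then there is a sequence of (data-dependent) sets $(J_m)_{m\ge1}$ with $J_m\subseteq\{1,\ldots,m\}$ such that $q_{\alpha,m}(J_m)\le\bar\pi_\alpha q$ for all $m$, and $\lim_{m\to\infty}\mathrm{P}(|J_m|/m\ge y)=1$ for some $y>0$.
   Context: Efron mixture model: $P(x)=\gamma x+(1-\gamma)P_1(x)$ on $[0,1]$ with $\gamma\in[0,1]$ and $P_1$ a distribution function with $P_1(x)\ge x$. Define $\bar\pi_a=\inf_{0\le x<1}\frac{1-P(xa)}{1-x}$ if $P(a)<1$ and $\bar\pi_a=0$ otherwise. $P$ is Simes-detectable at $a$ if $\bar\pi_a<1$ (equivalently, $P(xa)>x$ for some $0\le x<1$, or $P(a)=1$). For the first $m$ $p$-values: for $I\subseteq\{1,\ldots,m\}$, $p_{(i:I)}$ is the $i$-th smallest of $\{p_j:j\in I\}$; Simes test: $I\in\mathcal{U}_\alpha$ iff some $1\le i\le|I|$ has $|I|p_{(i:I)}\le i\alpha$; $\mathcal{X}_\alpha=\{I: J\in\mathcal{U}_\alpha\ \forall J\supseteq I, J\subseteq\{1,\ldots,m\}\}$; $t_{\alpha,m}(S)=\max\{|I|: I\subseteq S, I\notin\mathcal{X}_\alpha\}$; $q_{\alpha,m}(S)=t_{\alpha,m}(S)/|S|$ for $S\ne\emptyset$ and $0$ for $S=\emptyset$. *)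

(* Defs.v *)
From HB Require Import structures.
From mathcomp Require Import all_boot all_order all_algebra.
From mathcomp Require Import all_classical all_reals all_analysis.
Set Implicit Arguments. Unset Strict Implicit. Unset Printing Implicit Defensive.
Import Order.TTheory GRing.Theory Num.Theory.
Import numFieldNormedType.Exports.
Local Open Scope classical_set_scope.
Local Open Scope ring_scope.

Section Simes.
Variable R : realType.

Definition pibar (P : R -> R) (a : R) : R :=
  if P a < 1 then inf [set (1 - P (x * a)) / (1 - x) | x in `[0, 1[%classic]
  else 0.

Definition simes_detectable (P : R -> R) (a : R) : Prop := pibar P a < 1.

Definition efron_model (P : R -> R) : Prop :=
  exists (gamma : R) (P1 : R -> R),
    0 <= gamma <= 1 /\
    (forall x, 0 <= x <= 1 -> P x = gamma * x + (1 - gamma) * P1 x) /\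
    [/\ (forall x y, 0 <= x -> x <= y -> y <= 1 -> P1 x <= P1 y),
        (forall x, 0 <= x < 1 -> P1 x0 @[x0 --> x^'+] --> P1 x),
        (forall x, 0 <= x <= 1 -> 0 <= P1 x /\ P1 x <= 1) &
        (forall x, 0 <= x <= 1 -> x <= P1 x)].

(* p-values p : 'I_m -> R (index j : 'I_m stands for hypothesis j+1) *)
Definition sorted_pvals (m : nat) (p : 'I_m -> R) (I : {set 'I_m}) : seq R :=
  sort <=%R [seq p j | j <- enum I].

(* p_(i:I) for 1 <= i <= |I| is  nth 0 (sorted_pvals p I) (i-1) *)
Definition simes_rejects (alpha : R) (m : nat) (p : 'I_m -> R)
    (I : {set 'I_m}) : bool :=
  [exists i : 'I_#|I|,
     #|I|%:R * nth 0 (sorted_pvals p I) i <= (i.+1)%:R * alpha].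

Definition in_X (alpha : R) (m : nat) (p : 'I_m -> R) (I : {set 'I_m}) : bool :=
  [forall J : {set 'I_m}, (I \subset J) ==> simes_rejects alpha p J].

Definition t_am (alpha : R) (m : nat) (p : 'I_m -> R) (S : {set 'I_m}) : nat :=
  \max_(I : {set 'I_m} | (I \subset S) && ~~ in_X alpha p I) #|I|.

Definition q_am (alpha : R) (m : nat) (p : 'I_m -> R) (S : {set 'I_m}) : R :=
  if S == finset.set0 then 0 else (t_am alpha p S)%:R / #|S|%:R.

End Simes.

Definition pvec {R : realType} {T : Type} (p : nat -> T -> R) (m : nat) (w : T)
  : 'I_m -> R := fun j => p (nat_of_ord j) w.

(* p_1, p_2, ... (indexed from 0 here) are i.i.d. with distribution function P
   on [0,1]: measurable, supported in [0,1], cdf P on [0,1], and mutually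
   independent (product rule for every finite initial segment and all Borel
   sets, which is equivalent to independence of every finite subfamily). *)
Definition iid_with_cdf {R : realType} {d : measure_display}
    {T : measurableType d} (mu : probability T R) (p : nat -> T -> R)
    (P : R -> R) : Prop :=
  [/\ (forall i, measurable_fun setT (p i)),
      (forall i, mu [set w | 0 <= p i w <= 1] = 1%E),
      (forall i x, 0 <= x <= 1 -> mu [set w | p i w <= x] = (P x)%:E) &
      (forall (n : nat) (B : nat -> set R), (forall i, measurable (B i)) ->
         mu (\bigcap_(i in `I_n) (p i @^-1` B i)) =
         (\prod_(i < n) fine (mu (p i @^-1` B i)))%:E)].
Arguments pvec {R T} p m w j.

(* Main.v *)
Require Import Defs.
From HB Require Import structures.
From mathcomp Require Import all_boot all_order all_algebra.
From mathcomp Require Import all_classical all_reals all_analysis.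
From mathcomp Require Import measurable_realfun ring lra.
Import Order.TTheory GRing.Theory Num.Theory.
Import numFieldNormedType.Exports.
Local Open Scope classical_set_scope.
Local Open Scope ring_scope.

(** A set [K] that Simes does not reject contains at most [x * #|K|] p-values
    below [x * alpha], for every [x >= 0].  Applied with [x < 1], this bounds
    [#|K|] by [(m - #{p <= x alpha}) / (1 - x)], so by the law of large numbers
    [#|K| / m] is asymptotically at most [pibar P alpha].  Applied with [x * q],
    where [x] witnesses detectability, it bounds the part of [K] inside
    [S = {p <= x q alpha}] by [x q #|K|].  Since [#|S| / m] tends to
    [P (x q alpha) > x], the ratio [t(S) / #|S|] is eventually below
    [pibar P alpha * q] with strict room to spare.  The selected set is [S] when
    two empirical counts are large enough for this bound to hold, and empty
    otherwise. *)

(** * Counting p-values in sets that Simes does not reject *)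

Section SimesCounting.
Context {R : realType}.
Variables (alpha : R) (m : nat) (pv : 'I_m -> R).
Hypothesis alpha_gt0 : 0 < alpha.

Definition below (c : R) : {set 'I_m} := [set j | pv j <= c]%SET.

(** Let [c] be the cardinality on the left. The [c]-th smallest p-value of [K] is at most
    [x * alpha], and non-rejection at rank [c] makes [c * alpha] smaller than [#|K|] times that
    p-value. Ranks start at 0 in the code, hence [c.-1] and the need for [0 < c]. *)
Lemma unrejected_card_below_lt (K : {set 'I_m}) (x : R) :
  ~~ simes_rejects alpha pv K -> (0 < #|K :&: below (x * alpha)|)%N ->
  #|K :&: below (x * alpha)|%:R < x * #|K|%:R.
Proof.
set c := #|_| => /existsPn unrej c0.
have cK : (c.-1 < #|K|)%N by rewrite prednK// subset_leq_card// subsetIl.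
have := unrej (Ordinal cK); rewrite /= prednK// -ltNge => lt_c.
have nth_le : nth 0 (sorted_pvals pv K) c.-1 <= x * alpha.
  apply: nth_count_le; first by apply: sort_sorted; exact: le_total.
  rewrite prednK// /sorted_pvals count_sort count_map.
  rewrite /enum_mem count_filter /c cardE /enum_mem size_filter.
  rewrite sub_count// => j /=; rewrite !inE => /andP[-> ?].
  by rewrite andbT.
have := lt_le_trans lt_c (ler_wpM2l (ler0n _ _) nth_le).
by rewrite mulrA ltr_pM2r// mulrC.
Qed.

Lemma unrejected_card_below_le (K : {set 'I_m}) (x : R) :
  0 <= x -> ~~ simes_rejects alpha pv K ->
  #|K :&: below (x * alpha)|%:R <= x * #|K|%:R.
Proof.
move=> x0 unrej; have [c0|c0] := posnP #|K :&: below (x * alpha)|.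
  by rewrite c0 mulr_ge0.
exact/ltW/unrejected_card_below_lt.
Qed.

(** A set lies outside [in_X] exactly when some superset [K] is unrejected, so the maximum is
    controlled through such [K]. *)
Lemma t_am_le (S : {set 'I_m}) (b : R) : 0 <= b ->
  (forall I K : {set 'I_m}, I \subset S -> I \subset K ->
    ~~ simes_rejects alpha pv K -> #|I|%:R <= b) ->
  (t_am alpha pv S)%:R <= b.
Proof.
move=> b0 H; rewrite /t_am; elim/big_ind: _ => //.
  by move=> u v ub vb; rewrite /maxn; case: ifP.
move=> I /andP[IS /forallPn[K]]; rewrite negb_imply => /andP[IK unrej].
exact: H IS IK unrej.
Qed.

Lemma t_am_below_le (c x : R) : 0 <= c -> 0 <= x < 1 ->
  (1 - x) * (t_am alpha pv (below (c * alpha)))%:R <=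
  c * (m%:R - #|below (x * alpha)|%:R).
Proof.
move=> c0 /andP[x0 x1]; have x1' : 0 < 1 - x by rewrite subr_gt0.
have card_le (S : {set 'I_m}) : #|S|%:R <= m%:R :> R.
  by rewrite ler_nat -[leqRHS]card_ord max_card.
rewrite mulrC -ler_pdivlMr//; apply: t_am_le => [|I K IS IK unrej].
  by rewrite divr_ge0// ?(ltW x1')// mulr_ge0// subr_ge0.
rewrite ler_pdivlMr//.
(* [I] lies in both [K] and [below (c * alpha)]. *)
have I_le : #|I|%:R <= c * #|K|%:R.
  apply: le_trans (unrejected_card_below_le _ _ c0 unrej).
  by rewrite ler_nat subset_leq_card// finset.subsetI IK.
(* Split [K] by [below (x * alpha)]: the inner part is at most [x * #|K|], the outer part at most
   the size of the complement. *)
have K_le : (1 - x) * #|K|%:R <= m%:R - #|below (x * alpha)|%:R.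
  have : #|K|%:R <=
      #|K :&: below (x * alpha)|%:R + #|~: below (x * alpha)|%:R :> R.
    rewrite -natrD ler_nat -(cardsID (below (x * alpha)) K) leq_add2l.
    by rewrite subset_leq_card// finset.setDE finset.subsetIr.
  have -> : #|~: below (x * alpha)|%:R = m%:R - #|below (x * alpha)|%:R :> R.
    rewrite -[in m%:R](card_ord m) -(cardsC (below (x * alpha))) natrD.
    by rewrite addrC addKr.
  have := unrejected_card_below_le _ _ x0 unrej.
  lra.
rewrite (le_trans (ler_wpM2r (ltW x1') I_le))//.
by rewrite -mulrA ler_wpM2l// mulrC.
Qed.

Lemma card_below_full (c : R) :
  (m <= #|below c|)%N -> below c = [set: 'I_m]%SET.
Proof.
move=> full; apply/eqP.
by rewrite finset.eqEcard finset.subsetT cardsT card_ord.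
Qed.

(** The strict bound at [x = 1] would give [#|K| < #|K|] for any nonempty unrejected [K]. This
    serves the case [pibar P alpha = 0], where the bound must be exactly zero. *)
Lemma t_am_below_full :
  below alpha = [set: 'I_m]%SET -> t_am alpha pv (below alpha) = 0%N.
Proof.
move=> full; apply/eqP; rewrite -leqn0 -(ler_nat R).
apply: t_am_le => // I K _ IK unrej; rewrite leNgt ltr0n; apply/negP => I0.
have K0 : (0 < #|K :&: below (1 * alpha)|)%N.
  by rewrite mul1r full finset.setIT (leq_trans I0)// subset_leq_card.
have := unrejected_card_below_lt _ _ unrej K0.
by rewrite mul1r full finset.setIT mul1r ltxx.
Qed.

End SimesCounting.

(** * Weak law of large numbers for pairwise independent events *)

Section WeakLaw.
Context {R : realType} {d : measure_display} {T : measurableType d}.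
Variable mu : probability T R.

Lemma indic_Lfun2 (A : set T) :
  measurable A -> (\1_A : T -> R) \in Lfun mu 2%:E.
Proof.
move=> mA; rewrite inE/=; apply/andP; split; rewrite inE/=.
  exact: measurable_indic.
rewrite /finite_norm unlock poweR_lty//=.
under eq_integral => x _.
  rewrite (_ : `|\1_A x| `^ 2 = \1_A x).
    over.
  rewrite indicE; case: (x \in A); first by rewrite normr1 powR1.
  by rewrite normr0 powR0// pnatr_eq0.
by rewrite integral_indic// setIT (le_lt_trans (probability_le1 mu mA))// ltry.
Qed.

Lemma covariance_indic (A B : set T) (a b : R) :
  measurable A -> measurable B -> mu A = a%:E -> mu B = b%:E ->
  covariance mu (\1_A) (\1_B) = (mu (A `&` B) - (a * b)%:E)%E.
Proof.
move=> mA mB Aa Bb; rewrite covarianceE.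
- rewrite (_ : \1_A * \1_B = \1_(A `&` B)); last by rewrite indicI.
  rewrite !expectation_indic//; last exact: measurableI.
  by rewrite Aa Bb.
- by apply: Lfun_subset12; [exact: fin_num_measure|exact: indic_Lfun2].
- by apply: Lfun_subset12; [exact: fin_num_measure|exact: indic_Lfun2].
- exact: (Lfun2_mul_Lfun1 (indic_Lfun2 _ mA) (indic_Lfun2 _ mB)).
Qed.

Variables (A : nat -> set T) (r : R).
Hypothesis mA : forall i, measurable (A i).
Hypothesis muA : forall i, mu (A i) = r%:E.
Hypothesis muAI : forall i j, (i < j)%N -> mu (A i `&` A j) = (r * r)%:E.

Definition hits (n : nat) : T -> R := fun w => \sum_(i < n) \1_(A i) w.

Lemma hits0 : hits 0 = cst 0.
Proof. by apply/funext => w; rewrite /hits big_ord0. Qed.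

Lemma hitsS n : hits n.+1 = hits n \+ \1_(A n).
Proof. by apply/funext => w; rewrite /hits big_ord_recr. Qed.

Lemma hits_Lfun2 n : hits n \in Lfun mu 2%:E.
Proof.
elim: n => [|n IH]; first by rewrite hits0 Lfun_cst.
by rewrite hitsS rpredD ?lee1n//= indic_Lfun2.
Qed.

Lemma expectation_hits n : ('E_mu[hits n] = (n%:R * r)%:E)%E.
Proof.
have L1 (f : T -> R) : f \in Lfun mu 2%:E -> f \in Lfun mu 1.
  by apply: Lfun_subset12; exact: fin_num_measure.
elim: n => [|n IH]; first by rewrite hits0 expectation_cst mul0r.
rewrite hitsS expectationD ?L1 ?hits_Lfun2 ?indic_Lfun2//.
by rewrite IH expectation_indic// muA -EFinD -natr1 mulrDl mul1r.
Qed.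

Lemma covariance_hits n k :
  (n <= k)%N -> covariance mu (hits n) (\1_(A k)) = 0%E.
Proof.
elim: n => [|n IH] nk; first by rewrite hits0 covariance_cst_l.
rewrite hitsS covarianceDl ?hits_Lfun2 ?indic_Lfun2// IH ?(ltnW nk)// add0e.
by rewrite (covariance_indic _ _ _ _ _ _ (muA n) (muA k))// muAI// -EFinB subrr.
Qed.

(** The covariances vanish, so the variances [r - r * r] of the indicators add up. *)
Lemma variance_hits n : ('V_mu[hits n] = (n%:R * (r - r * r))%:E)%E.
Proof.
elim: n => [|n IH]; first by rewrite hits0 variance_cst mul0r.
rewrite hitsS varianceD ?hits_Lfun2 ?indic_Lfun2// IH.
rewrite covariance_hits// mule0 adde0.
rewrite /variance (covariance_indic _ _ _ _ _ _ (muA n) (muA n))// setIid muA.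
by rewrite -EFinB -EFinD -natr1 mulrDl mul1r.
Qed.

Lemma measurable_hits n : measurable_fun setT (hits n).
Proof. by have := hits_Lfun2 n; rewrite inE => /andP[]; rewrite inE. Qed.

Lemma measurable_hits_ge n (s : R) : measurable [set w | s <= hits n w].
Proof.
rewrite (_ : [set _ | _] = setT `&` hits n @^-1` `[s, +oo[).
  exact: measurable_hits.
by apply/seteqP; split => w /=; rewrite ?in_itv/= ?andbT// => -[].
Qed.

(** Chebyshev with deviation [n * e], where [e = r - s]: the failure probability is at most
    [(r - r * r) / (e ^ 2 * n)], hence at most [1 / (e ^ 2 * n)]. *)
Lemma cvg_measure_hits_ge (s : R) : s < r ->
  mu [set w | s * n%:R <= hits n w] @[n --> \oo] --> 1%E.
Proof.
move=> sr; set e := r - s; have e0 : 0 < e by rewrite subr_gt0.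
apply: (@squeeze_cvge _ _ _ _
    (fun n => (1 - e ^- 2 * (n%:R)^-1)%:E) _ (cst 1%E)); last exact: cvg_cst.
- near=> n; apply/andP; split; last first.
    by apply: probability_le1; exact: measurable_hits_ge.
  have n0 : (0 < n)%N by near: n; exact: nbhs_infty_gt.
  have n0R : 0 < n%:R :> R by rewrite ltr0n.
  pose X : {mfun T >-> R} := HB.pack (hits n)
    (isMeasurableFun.Build _ _ _ _ _ (measurable_hits n)).
  have := @chebyshev _ _ _ mu X (n%:R * e) (mulr_gt0 n0R e0).
  rewrite expectation_hits variance_hits/= => cheb.
  have mC : measurable [set w | n%:R * e <= `|hits n w - n%:R * r|].
    rewrite (_ : [set _ | _] = setT `&`
       (fun w => `|hits n w - n%:R * r|) @^-1` `[n%:R * e, +oo[).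
      apply: measurableT_comp => //.
      by apply: measurable_funB => //; exact: measurable_hits.
    by apply/seteqP; split => w /=; rewrite ?in_itv/= ?andbT// => -[].
  apply: (@le_trans _ _ (mu (~` [set w | n%:R * e <= `|hits n w - n%:R * r|]))).
    rewrite probability_setC// EFinB leeB// (le_trans cheb)//.
    rewrite -EFinM lee_fin exprMn invfM mulrACA -[leRHS]mulr1.
    have rr1 : r - r * r <= 1.
      have : (mu (A 0%N) <= 1)%E by exact: probability_le1.
      rewrite muA lee_fin => r1.
      have : (0 <= mu (A 0%N))%E by [].
      rewrite muA lee_fin => r0; nra.
    have -> : n%:R ^- 2 * n%:R * (e ^- 2 * (r - r * r)) =
              (e ^- 2 / n%:R) * (r - r * r).
      by field; rewrite !gt_eqF.
    by rewrite ler_wpM2l// mulr_ge0// invr_ge0 ?sqr_ge0// ltW.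
  apply: le_measure; rewrite ?inE//.
  - exact: measurableC.
  - exact: measurable_hits_ge.
  - move=> w /= /negP; rewrite -ltNge ltr_norml => /andP[+ _].
    rewrite /e; lra.
- apply: cvg_EFin; first exact: nearW.
  rewrite -[X in _ --> X]subr0 -(mulr0 (e ^- 2)).
  apply: cvgB; first exact: cvg_cst.
  apply: cvgM; first exact: cvg_cst.
  have n_gt0 : \forall n \near \oo, 0 < n%:R :> R.
    by near=> n; rewrite ltr0n; near: n; exact: nbhs_infty_gt.
  exact: (proj2 (gtr0_cvgV0 n_gt0) (@cvgr_idn R)).
Unshelve. all: by end_near. Qed.

End WeakLaw.

(** Since [E n] is covered by its intersection with [F n] and the complement of [F n], the
    intersection has measure at least [mu (E n) + mu (F n) - 1]. *)
Lemma cvg_measure_setI {R : realType} {d : measure_display}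
    {T : measurableType d}
    (mu : probability T R) (E F : nat -> set T) :
  (forall n, measurable (E n)) -> (forall n, measurable (F n)) ->
  mu (E n) @[n --> \oo] --> 1%E -> mu (F n) @[n --> \oo] --> 1%E ->
  mu (E n `&` F n) @[n --> \oo] --> 1%E.
Proof.
move=> mE mF cE cF.
apply: (@squeeze_cvge _ _ _ _
    (fun n => (mu (E n) + mu (F n) - 1)%E) _ (cst 1%E)); last exact: cvg_cst.
- apply: nearW => n; apply/andP; split; last first.
    by apply: probability_le1; exact: measurableI.
  have mu_fin (A : set T) : measurable A -> mu A = (fine (mu A))%:E.
    by move=> mA; rewrite fineK// fin_num_measure.
  have : (mu (E n) <= mu (E n `&` F n) + (1 - mu (F n)))%E.
    rewrite -probability_setC//.
    apply: le_trans (measureU2 _ _ _) => //.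
    + apply: le_measure; rewrite ?inE//.
        by apply: measurableU; [exact: measurableI|exact: measurableC].
      by move=> w Ew; have [Fw|nFw] := pselect (F n w); [left|right].
    + exact: measurableI.
    + exact: measurableC.
  rewrite (mu_fin _ (mE n)) (mu_fin _ (mF n)).
  rewrite (mu_fin _ (measurableI _ _ (mE n) (mF n))).
  rewrite -!(EFinD, EFinB) !lee_fin; lra.
- rewrite [X in _ --> X](_ : _ = (1 + 1 - 1)%E); last by rewrite -!EFinD addrK.
  by apply: cvgeB; [|apply: cvgeD|exact: cvg_cst].
Qed.

(** * Measurable selection of the sets from two empirical counts *)

Section Selection.
Context {R : realType} {d : measure_display} {T : measurableType d}.
Variables (mu : probability T R) (p : nat -> T -> R).
Hypothesis mp : forall i, measurable_fun setT (p i).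

Lemma measurable_pval_le (i : nat) (c : R) : measurable [set w | p i w <= c].
Proof.
rewrite (_ : [set _ | _] = setT `&` p i @^-1` `]-oo, c]); first exact: mp.
by apply/seteqP; split => w /=; rewrite ?in_itv/=// => -[].
Qed.

Lemma measurable_below_eq (m : nat) (c : R) (S : {set 'I_m}) :
  measurable [set w | below m (pvec p m w) c = S].
Proof.
rewrite (_ : [set _ | _] = \bigcap_(j in [set: 'I_m])
   if j \in S then [set w | p j w <= c] else ~` [set w | p j w <= c]).
  apply: fin_bigcap_measurable => // j _; case: ifP => _.
    exact: measurable_pval_le.
  by apply: measurableC; exact: measurable_pval_le.
apply/seteqP; split => w /=.
  by move=> <- j _; rewrite inE /pvec; case: ifPn => // /negP.
move=> H; apply/setP => j; rewrite inE; have := H j I.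
by case: (j \in S) => //= /negP/negbTE.
Qed.

(** The pair of sets takes finitely many values, so every event it determines is a finite union of
    measurable ones. *)
Lemma measurable_below_pred (m : nat) (c c' : R)
    (Q : {set 'I_m} -> {set 'I_m} -> Prop) :
  measurable [set w | Q (below m (pvec p m w) c) (below m (pvec p m w) c')].
Proof.
rewrite (_ : [set _ | _] = \bigcup_(AB in
      [set AB : {set 'I_m} * {set 'I_m} | Q AB.1 AB.2])
   ([set w | below m (pvec p m w) c = AB.1] `&`
    [set w | below m (pvec p m w) c' = AB.2])).
  apply: fin_bigcup_measurable => // AB _.
  by apply: measurableI; exact: measurable_below_eq.
apply/seteqP; split => [w /= Qw|w [[A B]] /= QAB [-> ->]//].
by exists (below m (pvec p m w) c, below m (pvec p m w) c').
Qed.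

Lemma below_hits (m : nat) (c : R) (w : T) :
  #|below m (pvec p m w) c|%:R = hits (fun i => [set w | p i w <= c]) m w :> R.
Proof.
rewrite /hits -sum1_card natr_sum big_mkcond/=; apply: eq_bigr => j _.
rewrite indicE inE /pvec; case: ifPn => H; first by rewrite mem_set.
by rewrite memNset//; exact/negP.
Qed.

(** The bound on [q_am] has to hold at every outcome, while the counts are large only with
    probability tending to 1. Falling back on the empty set, where [q_am] is 0, reconciles the
    two. *)
Lemma selected_sets_of_counts (alpha b c c' s s' : R) :
  0 <= b -> 0 < s ->
  (forall m w, (0 < m)%N ->
    s * m%:R <= #|below m (pvec p m w) c|%:R ->
    s' * m%:R <= #|below m (pvec p m w) c'|%:R ->
    q_am alpha (pvec p m w) (below m (pvec p m w) c) <= b) ->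
  mu [set w | s * m%:R <= #|below m (pvec p m w) c|%:R] @[m --> \oo] --> 1%E ->
  mu [set w | s' * m%:R <= #|below m (pvec p m w) c'|%:R] @[m --> \oo] --> 1%E ->
  exists J : forall m : nat, T -> {set 'I_m},
    [/\ (forall (m : nat) (w w' : T), (forall j : 'I_m, p j w = p j w') -> J m w = J m w'),
        (forall (m : nat) (S : {set 'I_m}), measurable [set w | J m w = S]),
        (forall (m : nat) (w : T), (0 < m)%N ->
           q_am alpha (pvec p m w) (J m w) <= b) &
        exists y : R, 0 < y /\
          (fun m : nat => mu [set w | y <= #|J m w|%:R / m%:R]) @ \oo
            --> 1%E].
Proof.
move=> b0 s0 Hq cvg cvg'.
(* The rule acts on the two sets alone, so [measurable_below_pred] applies to [J]. *)
pose F m (A B : {set 'I_m}) : {set 'I_m} :=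
  if (s * m%:R <= #|A|%:R) && (s' * m%:R <= #|B|%:R) then A else finset.set0.
pose J m w := F m (below m (pvec p m w) c) (below m (pvec p m w) c').
exists J; split.
- move=> m w w' eqp; rewrite /J.
  by have -> : pvec p m w = pvec p m w' by apply/funext => j; exact: eqp.
- move=> m S; exact: (measurable_below_pred m c c' (fun A B => F m A B = S)).
- move=> m w m0; rewrite /J /F; case: ifP => [/andP[]|_]; first exact: Hq.
  by rewrite /q_am eqxx.
exists s; split => //.
pose E m := [set w | s * m%:R <= #|below m (pvec p m w) c|%:R].
pose E' m := [set w | s' * m%:R <= #|below m (pvec p m w) c'|%:R].
have mE m : measurable (E m).
  exact: (measurable_below_pred m c c (fun A _ => s * m%:R <= #|A|%:R)).
have mE' m : measurable (E' m).
  exact: (measurable_below_pred m c' c' (fun A _ => s' * m%:R <= #|A|%:R)).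
apply: (@squeeze_cvge _ _ _ _ (fun m => mu (E m `&` E' m)) _ (cst 1%E)).
- near=> m; have m0 : (0 < m)%N by near: m; exact: nbhs_infty_gt.
  have mJ : measurable [set w | s <= #|J m w|%:R / m%:R].
    exact: (measurable_below_pred m c c' (fun A B => s <= #|F m A B|%:R / m%:R)).
  apply/andP; split; last exact: probability_le1.
  apply: le_measure; rewrite ?inE//; first exact: measurableI.
  by move=> w /= [Ew E'w]; rewrite /J /F Ew E'w ler_pdivlMr// ltr0n.
- exact: cvg_measure_setI.
- exact: cvg_cst.
Unshelve. all: by end_near. Qed.

End Selection.

(** * Empirical counts of i.i.d. p-values *)

Section IidPvalues.
Context {R : realType} {d : measure_display} {T : measurableType d}.
Variables (mu : probability T R) (p : nat -> T -> R) (P : R -> R).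
Hypothesis iid : iid_with_cdf mu p P.

Lemma iid_cdf_nondecreasing (x y : R) :
  0 <= x -> x <= y -> y <= 1 -> P x <= P y.
Proof.
move=> x0 xy y1; case: iid => mp _ cdfP _; rewrite -lee_fin.
rewrite -(cdfP 0%N) ?x0 ?(le_trans xy)// -(cdfP 0%N) ?y1 ?(le_trans x0)//.
apply: le_measure; rewrite ?inE; [exact: measurable_pval_le..|].
by move=> w /= /le_trans; apply.
Qed.

Lemma iid_cdf_le1 (x : R) : 0 <= x <= 1 -> P x <= 1.
Proof.
move=> x01; case: iid => mp _ cdfP _; rewrite -lee_fin -(cdfP 0%N)//.
by apply: probability_le1; exact: measurable_pval_le.
Qed.

Lemma iid_setI (i j : nat) (c : R) : 0 <= c <= 1 -> (i < j)%N ->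
  mu ([set w | p i w <= c] `&` [set w | p j w <= c]) = (P c * P c)%:E.
Proof.
move=> c01 ij; case: iid => mp _ cdfP indep.
(* The product rule covers initial segments only; taking the whole line at all other indices up to
   [j] isolates the pair. *)
pose B k : set R := if (k == i) || (k == j) then `]-oo, c]%classic else setT.
have mB k : measurable (B k) by rewrite /B; case: ifP.
have ji : (j == i) = false by rewrite gtn_eqF.
have pre k : p k @^-1` `]-oo, c]%classic = [set w | p k w <= c].
  by apply/seteqP; split => w /=; rewrite in_itv.
have := indep j.+1 B mB.
rewrite (_ : \bigcap_(k in _) _ =
    [set w | p i w <= c] `&` [set w | p j w <= c]); last first.
  apply/seteqP; split => w /=.
    move=> H; have := H i (ltnW ij : (i < j.+1)%N); have := H j (ltnSn j).
    by rewrite /B !eqxx orbT/= !in_itv/=; split.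
  move=> [wi wj] k _; rewrite /preimage /B/=; case: ifP => // /orP[]/eqP->;
    by rewrite /= in_itv.
move=> ->; congr EFin.
rewrite (bigD1 (Ordinal (ltnW ij : (i < j.+1)%N)))//=.
rewrite (bigD1 ord_max)/=; last first.
  by rewrite -val_eqE/= ji.
rewrite big1 ?mulr1.
  by rewrite /B !eqxx orbT/= !pre !cdfP.
move=> k /andP[ki kj]; rewrite /B -!val_eqE/= in ki kj *.
by rewrite (negbTE ki) (negbTE kj)/= preimage_setT probability_setT.
Qed.

Lemma cvg_measure_below_ge (c s : R) : 0 <= c <= 1 -> s < P c ->
  mu [set w | s * m%:R <= #|below m (pvec p m w) c|%:R] @[m --> \oo] --> 1%E.
Proof.
move=> c01 sP; case: iid => mp _ cdfP _.
under eq_fun do under eq_set do rewrite below_hits.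
apply: (cvg_measure_hits_ge _ _ (P c)) => //.
- by move=> i; exact: measurable_pval_le.
- by move=> i; exact: cdfP.
- by move=> i j ij; exact: iid_setI.
Qed.

(** The weak law needs a threshold strictly below [P c]. At threshold 1 the event says that all [m]
    p-values are at most [c], which has probability [1 ^ m]. *)
Lemma measure_below_full (c : R) (m : nat) : 0 <= c <= 1 -> P c = 1 ->
  mu [set w | (1 : R) * m%:R <= #|below m (pvec p m w) c|%:R] = 1%E.
Proof.
move=> c01 Pc; case: iid => mp _ cdfP indep.
rewrite (_ : [set _ | _] = \bigcap_(i in `I_m) p i @^-1` `]-oo, c]%classic).
  rewrite (indep m (fun=> `]-oo, c]%classic))// big1// => i _.
  rewrite (_ : p i @^-1` _ = [set w | p i w <= c]) ?cdfP ?Pc//.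
apply/seteqP; split => w /=; rewrite mul1r ler_nat.
  move=> /card_below_full full i im.
  by have := finset.in_setT (Ordinal im); rewrite -full inE /= in_itv.
move=> H; rewrite -[leqLHS]card_ord -cardsT subset_leq_card//.
apply/fintype.subsetP => j _; rewrite inE /pvec.
by have := H j (ltn_ord j); rewrite /= in_itv.
Qed.

End IidPvalues.

(** * Witnesses for the infimum, and choice of the thresholds *)

Lemma pibar_ltP {R : realType} (P : R -> R) (a v : R) :
  P a < 1 -> pibar P a < v ->
  exists2 x, 0 <= x < 1 & 1 - P (x * a) < v * (1 - x).
Proof.
rewrite /pibar => -> lt_v; apply: contrapT => /forall2NP none.
suff : v <= inf [set (1 - P (x * a)) / (1 - x) | x in `[0, 1[%classic].
  by rewrite leNgt lt_v.
apply: lb_le_inf.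
  exists ((1 - P (0 * a)) / (1 - 0)), 0 => //=.
  by rewrite in_itv/= lexx ltr01.
move=> y [x /=]; rewrite in_itv/= => x01 <-{y}.
have [//|/negP] := none x; rewrite -leNgt ler_pdivlMr// subr_gt0.
by case/andP: x01.
Qed.

Theorem theorem2 (R : realType) (d : measure_display) (T : measurableType d)
    (mu : probability T R) (alpha : R) (P : R -> R) (p : nat -> T -> R)
    (q : R) :
  0 < alpha < 1 ->
  efron_model P ->
  iid_with_cdf mu p P ->
  0 <= q <= 1 ->
  simes_detectable P (q * alpha) ->
  exists J : forall m : nat, T -> {set 'I_m},
    [/\ (forall (m : nat) (w w' : T), (forall j : 'I_m, p j w = p j w') -> J m w = J m w'),
        (forall (m : nat) (S : {set 'I_m}), measurable [set w | J m w = S]),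
        (forall (m : nat) (w : T), (0 < m)%N ->
           q_am alpha (pvec p m w) (J m w) <= pibar P alpha * q) &
        exists y : R, 0 < y /\
          (fun m : nat => mu [set w | y <= #|J m w|%:R / m%:R]) @ \oo
            --> 1%E].
Proof.
move=> /andP[alpha0 alpha1] _ iid /andP[q0 q1] detect.
have alpha_ge0 := ltW alpha0; have alpha_le1 := ltW alpha1.
have mp : forall i, measurable_fun setT (p i) by case: iid.
have scale01 (x : R) : 0 <= x -> x <= 1 -> 0 <= x * alpha <= 1.
  by move=> x0 x1; rewrite mulr_ge0//= mulr_ile1.
have alpha01 : 0 <= alpha <= 1 by rewrite alpha_ge0.
have [Palpha|] := ltP (P alpha) 1; last first.
  move=> Palpha; have Palpha1 : P alpha = 1.
    by apply/eqP; rewrite eq_le Palpha (iid_cdf_le1 _ _ _ iid).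
  have pibar0 : pibar P alpha = 0 by rewrite /pibar Palpha1 ltxx.
  have full_ae : mu [set w | (1 : R) * m%:R <= #|below m (pvec p m w) alpha|%:R]
      @[m --> \oo] --> 1%E.
    rewrite (_ : (fun m => _) = cst 1%E); first exact: cvg_cst.
    by apply/funext => m; exact: (measure_below_full _ _ _ iid).
  (* Here the selected set is all of the indices or empty; the second count repeats the first. *)
  apply: (selected_sets_of_counts _ _ mp _ _ alpha alpha 1 1) => //.
    by rewrite pibar0 mul0r.
  move=> m w m0 + _; rewrite mul1r ler_nat pibar0 mul0r => full.
  rewrite /q_am; case: ifP => // _; rewrite t_am_below_full ?mul0r//.
  exact: card_below_full.
have Pq : P (q * alpha) < 1.
  apply: le_lt_trans Palpha; apply: (iid_cdf_nondecreasing _ _ _ iid) => //.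
    by rewrite mulr_ge0.
  by rewrite ler_piMl.
(* Detectability, read with [v = 1], yields [x < P (x * q * alpha)]. *)
have [x /andP[x0 x1]] := pibar_ltP _ _ _ Pq detect.
rewrite mul1r mulrA => xP.
set c := x * q; have c0 : 0 <= c by rewrite mulr_ge0.
have c1 : c <= 1 by rewrite mulr_ile1// ltW.
set pi := pibar P alpha.
(* Each quotient in the infimum is at least [1 - P alpha]. Positivity makes [v] below strictly
   larger than [pi]. *)
have pi0 : 0 < pi.
  rewrite (lt_le_trans (_ : 0 < 1 - P alpha)) ?subr_gt0// /pi /pibar Palpha.
  apply: lb_le_inf.
    exists ((1 - P (0 * alpha)) / (1 - 0)), 0 => //=.
    by rewrite in_itv/= lexx ltr01.
  move=> y [z /=]; rewrite in_itv/= => /andP[z0 z1] <-{y}.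
  rewrite ler_pdivlMr ?subr_gt0//.
  have : P (z * alpha) <= P alpha.
    apply: (iid_cdf_nondecreasing _ _ _ iid) => //.
      by case/andP: (scale01 z z0 (ltW z1)).
    by rewrite ler_piMl// ltW.
  nra.
(* The midpoint leaves room on both sides: below [P (c * alpha)] for the weak law, above [x] for the
   final estimate. *)
pose s := (P (c * alpha) + x) / 2.
have xs : x < s by rewrite /s /c; lra.
have sP : s < P (c * alpha) by rewrite /s /c; lra.
(* [v] exceeds [pi], yet [x * v <= pi * s] because
   [s - x * (1 + (s - x)) = (1 - x) * (s - x)]. *)
pose v := pi * (1 + (s - x)).
have [z /andP[z0 z1] zP] :
    exists2 z, 0 <= z < 1 & 1 - P (z * alpha) < v * (1 - z).
  apply: pibar_ltP => //; rewrite -/pi /v ltr_pMr//; lra.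
(* By [zP] this is below [P (z * alpha)], and a count of at least [s' * m] leaves at most
   [v * (1 - z) * m] p-values above [z * alpha]. *)
pose s' := 1 - v * (1 - z).
apply: (selected_sets_of_counts _ _ mp _ _ (c * alpha) (z * alpha) s s').
- by rewrite mulr_ge0 ?(ltW pi0).
- exact: le_lt_trans x0 xs.
- move=> m w m0 sA s'B; have m0R : 0 < m%:R :> R by rewrite ltr0n.
  rewrite /q_am; case: ifPn => [_|A0]; first by rewrite mulr_ge0 ?(ltW pi0).
  rewrite ler_pdivrMr ?ltr0n ?card_gt0//.
  have z01 : 0 <= z < 1 by rewrite z0.
  have := t_am_below_le alpha m (pvec p m w) alpha0 c z c0 z01.
  set t := _%:R => t_le.
  rewrite -(ler_pM2l (_ : 0 < 1 - z)) ?subr_gt0//.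
  apply: (le_trans t_le).
  apply: (@le_trans _ _ (c * (v * (1 - z) * m%:R))).
    by rewrite ler_wpM2l//; rewrite /s' in s'B; lra.
  apply: (@le_trans _ _ ((1 - z) * (pi * q * (s * m%:R)))); last first.
    by rewrite ler_wpM2l ?subr_ge0 ?(ltW z1)// ler_wpM2l// mulr_ge0// ltW.
  have -> : c * (v * (1 - z) * m%:R) =
      (1 - z) * (pi * q * (x * (1 + (s - x)) * m%:R)) by rewrite /c /v; ring.
  rewrite ler_wpM2l ?subr_ge0 ?(ltW z1)// ler_wpM2l ?(mulr_ge0 (ltW pi0))//.
  rewrite ler_wpM2r//.
  have : 0 <= (1 - x) * (s - x) by rewrite mulr_ge0 ?subr_ge0 ?ltW.
  lra.
- by apply: (cvg_measure_below_ge _ _ _ iid) => //; exact: scale01.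
- apply: (cvg_measure_below_ge _ _ _ iid); first exact: scale01 z0 (ltW z1).
  by rewrite /s'; lra.
Qed.
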